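(* Let $\mathcal{L}$ be a bounded lattice and let $\mathcal{Q}$ be a proper filter of $\mathcal{L}$ with $\mathcal{Q}\neq\{1\}$. Then the filter $\{1\}$ is a $\mathcal{Q}$-filter of $\mathcal{L}$ if and only if $\mathrm{Id}(\mathcal{L})\subseteq\mathcal{Q}$. Furthermore, if $\mathcal{L}$ is an $\mathcal{L}$-domain, then $\{1\}$ is a $\mathcal{Q}$-filter of $\mathcal{L}$ for every proper filter $\mathcal{Q}$ of $\mathcal{L}$.
   Context: All lattices are bounded, with least element $0$ and greatest element $1$ (not assumed distributive). A filter of $\mathcal{L}$ is a non-empty subset $F$ such that $u\wedge v\in F$ for all $u,v\in F$, and $u\in F$, $w\in\mathcal{L}$, $u\le w$ imply $w\in F$; it is proper if $F\neq\mathcal{L}$. For proper filters $\mathcal{P},\mathcal{Q}$ of $\mathcal{L}$, $\mathcal{P}$ is a $\mathcal{Q}$-filter of $\mathcal{L}$ if for all $u,v\in\mathcal{L}$, $u\vee v\in\mathcal{P}$ and $u\notin\mathcal{Q}$ imply $v\in\mathcal{P}$. An element $u\in\mathcal{L}$ is an identity join of $\mathcal{L}$ if there exists $v\in\mathcal{L}$ with $v\neq 1$ and $u\vee v=1$; $\mathrm{Id}(\mathcal{L})$ is the set of all identity joins. $\mathcal{L}$ is called an $\mathcal{L}$-domain if for all $u,v\in\mathcal{L}$, $u\vee v=1$ implies $u=1$ or $v=1$. *)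

(* Defs.v *)
From mathcomp Require Import all_boot all_order.
From mathcomp Require Import boolp classical_sets.

Set Implicit Arguments.
Unset Strict Implicit.
Unset Printing Implicit Defensive.

Local Open Scope classical_set_scope.

(* Lattice joins and meets are tagged with %O: without it they would be parsed
   as unions and intersections of sets. A tbLatticeType is a bounded lattice,
   not assumed distributive; the one-element lattice (\bot = \top) is allowed,
   but it has no proper filter. *)

Definition lattice_filter (d : Order.disp_t) (L : tbLatticeType d)
    (F : set L) : Prop :=
  [/\ F !=set0,
      forall u v : L, F u -> F v -> F (u `&` v)%O
    & forall u w : L, F u -> (u <= w)%O -> F w].

Definition proper_filter (d : Order.disp_t) (L : tbLatticeType d)
    (F : set L) : Prop :=
  lattice_filter F /\ F <> [set: L].

Definition is_Qfilter (d : Order.disp_t) (L : tbLatticeType d)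
    (Q P : set L) : Prop :=
  [/\ proper_filter P, proper_filter Q
    & forall u v : L, P (u `|` v)%O -> ~ Q u -> P v].

Definition identity_join (d : Order.disp_t) (L : tbLatticeType d)
    (u : L) : Prop :=
  exists v : L, v <> Order.top /\ (u `|` v)%O = Order.top.

Definition identity_joins (d : Order.disp_t) (L : tbLatticeType d) : set L :=
  [set u : L | identity_join u].

Arguments identity_joins {d} L.

Definition lattice_domain (d : Order.disp_t) (L : tbLatticeType d) : Prop :=
  forall u v : L,
    (u `|` v)%O = Order.top -> u = Order.top \/ v = Order.top.

(* Main.v *)
Require Import Defs.
From mathcomp Require Import all_boot all_order.
From mathcomp Require Import boolp classical_sets.

(** For [P = [set \top]] the defining implication of a Q-filter reads: if
    [u `|` v = \top] and [u] is outside [Q], then [v = \top]. Exchanging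
    hypothesis and conclusion by contraposition, any [u] joining to [\top] with
    some [v <> \top] lies in [Q], that is, [Q] contains the identity joins; this
    is [Qfilter_top_iff]. The remaining clause, that [[set \top]] is a proper
    filter, holds because a lattice with a proper filter has at least two
    elements ([proper_filter_set_top]). In a domain the only possible identity
    join is [\top], which belongs to every filter, so every proper filter
    contains all identity joins. *)

Import Order.LTheory.

Local Open Scope classical_set_scope.

Lemma lattice_filter_top (d : Order.disp_t) (L : tbLatticeType d) (Q : set L) :
  lattice_filter Q -> Q Order.top.
Proof. by move=> [[x Qx] _ upQ]; apply: (upQ x) => //; exact: lex1. Qed.

Lemma lattice_filter_set_top (d : Order.disp_t) (L : tbLatticeType d) :
  lattice_filter [set (Order.top : L)].
Proof.
split=> [|u v /= -> ->|u w /= ->]; first by exists Order.top.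
- by rewrite meetxx.
- by rewrite le1x => /eqP.
Qed.

(** Every filter contains [\top], so if [[set \top]] were the whole lattice,
    then every filter would be the whole lattice too. *)
Lemma proper_filter_set_top (d : Order.disp_t) (L : tbLatticeType d)
    (Q : set L) :
  proper_filter Q -> proper_filter [set (Order.top : L)].
Proof.
move=> [filQ QnT]; split; first exact: lattice_filter_set_top.
move=> topT; apply: QnT; apply/seteqP; split=> // x.
by rewrite -topT /= => ->; exact: lattice_filter_top.
Qed.

Lemma Qfilter_top_iff (d : Order.disp_t) (L : tbLatticeType d) (Q : set L) :
  proper_filter Q ->
  (is_Qfilter Q [set (Order.top : L)] <-> identity_joins L `<=` Q).
Proof.
move=> pQ; split=> [[_ _ Qtop] u [v [vn1 uv1]]|IdQ].
  by apply: contrapT => nQu; apply: vn1; exact: (Qtop u).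
split=> //; first exact: proper_filter_set_top pQ.
move=> u v /= uv1 nQu; apply: contrapT => vn1.
by apply: nQu; apply: IdQ; exists v.
Qed.

Lemma lattice_domain_identity_joins (d : Order.disp_t) (L : tbLatticeType d) :
  lattice_domain L -> identity_joins L `<=` [set (Order.top : L)].
Proof. by move=> domL u [v [vn1 /domL[]]]. Qed.

Theorem proposition3p4 (d : Order.disp_t) (L : tbLatticeType d) :
  (forall Q : set L, proper_filter Q -> Q <> [set (Order.top : L)] ->
     (is_Qfilter Q [set (Order.top : L)] <-> identity_joins L `<=` Q))
  /\
  (lattice_domain L ->
     forall Q : set L, proper_filter Q -> is_Qfilter Q [set (Order.top : L)]).
Proof.
split=> [Q pQ _|domL Q pQ]; first exact: Qfilter_top_iff.
apply/(Qfilter_top_iff _ _ _ pQ) => u /(lattice_domain_identity_joins _ _ domL) /= ->.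
exact: lattice_filter_top pQ.1.
Qed.
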